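(* Let $p$ be a prime with $p\equiv -1\pmod 4$. Then for all integers $\alpha\ge0$ and $n\ge0$, \[ \sum_{n=0}^{\infty}b_{16}\!\left(p^{2\alpha}n+\frac{5p^{2\alpha}-5}{8}\right)q^{n} \equiv \psi(q)\psi(q^4) \pmod 2, \] and \[ b_{16}\!\left(p^{2\alpha+2}n+\frac{(8i+5p)p^{2\alpha+1}-5}{8}\right)\equiv 0 \pmod 2,\qquad i=1,2,\ldots,p-1. \]
   Context: For a positive integer $\ell$, $b_\ell(n)$ denotes the number of partitions of $n$ having no part divisible by $\ell$. $\psi(q)=\sum_{n\ge0}q^{n(n+1)/2}$. A congruence between power series modulo $2$ means coefficientwise congruence. *)

(* Defs.v *)
From mathcomp Require Import all_boot.
Set Implicit Arguments. Unset Strict Implicit. Unset Printing Implicit Defensive.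

Definition is_partition (n : nat) (s : seq nat) : bool :=
  [&& sorted geq s, all (fun x => 0 < x) s & sumn s == n].

(* parts_le m n = list of all partitions of n whose parts are all <= m
   (each listed once, as a nonincreasing sequence): choose the number k of
   parts equal to m, then partition the rest with parts <= m-1. *)
Fixpoint parts_le (m n : nat) : seq (seq nat) :=
  match m with
  | 0 => if n == 0 then [:: [::]] else [::]
  | m'.+1 => flatten [seq [seq ncons k m'.+1 s | s <- parts_le m' (n - k * m'.+1)]
                     | k <- iota 0 (n %/ m'.+1).+1]
  end.

Definition partitions (n : nat) : seq (seq nat) := parts_le n n.

Definition b (l n : nat) : nat :=
  count (fun s => all (fun x => ~~ (l %| x)) s) (partitions n).

Definition series := nat -> nat.

Definition series_mul (f g : series) : series :=
  fun n => \sum_(0 <= k < n.+1) f k * g (n - k).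

Definition series_subst (j : nat) (f : series) : series :=
  fun n => if j %| n then f (n %/ j) else 0.

(* psi(q) = sum_{m>=0} q^{m(m+1)/2}: coefficient of q^n. *)
Definition psi : series :=
  fun n => \sum_(0 <= m < n.+1) (m * m.+1 %/ 2 == n).

Definition cong2 (f g : series) : Prop := forall n, f n = g n %[mod 2].

(* Main.v *)
Require Import Defs.
From mathcomp Require Import all_boot all_algebra.
From mathcomp Require Import ring zify.

(** Modulo 2 the generating function of [b 16] is [F^16 / F = F^15] with
[F = \prod_(k >= 1) (1 + q^k)], while Gauss's identity gives [psi = F^3]; hence
it is [psi^5 = psi(q) psi(q^4)], and [b 16 n] has the parity of the number of
representations [8 n + 5 = x^2 + 4 y^2] with [x], [y] odd and positive.  A prime
[p = 3 mod 4] dividing [x^2 + (2 y)^2] divides both [x] and [y], so scaling by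
[p] identifies the representations of [M] with those of [p^2 M], and there are
none for a number that [p] divides exactly once. *)

Set Implicit Arguments. Unset Strict Implicit. Unset Printing Implicit Defensive.
Import GRing.Theory.
Local Open Scope ring_scope.

(** * Triangular numbers *)

Notation tri k := (k * k.+1 %/ 2)%N.

Lemma mul2_tri k : (2 * tri k = k * k.+1)%N.
Proof. by rewrite divn2 mul2n -[RHS]odd_double_half oddM /= andbN. Qed.

Lemma tri_double k : tri (2 * k) = (k * (2 * k + 1))%N.
Proof. have := mul2_tri (2 * k); nia. Qed.

Lemma triS k : tri k.+1 = (tri k + k.+1)%N.
Proof. have := mul2_tri k; have := mul2_tri k.+1; nia. Qed.

Lemma leq_tri k : (k <= tri k)%N.
Proof. have := mul2_tri k; nia. Qed.

(** * A finite form of Gauss's identity *)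

Section FiniteGauss.
Variables (R : comNzRingType) (q : R).

(** For s <= n this is the quotient (q^2;q^2)_n / (q^2;q^2)_s of q-Pochhammer symbols, written
    without division; [odds n] is (q;q^2)_n. *)
Definition evens s n := \prod_(s <= k < n) (1 - q ^+ (2 * k + 2)).
Definition odds n := \prod_(0 <= k < n) (1 - q ^+ (2 * k + 1)).

(* Shanks's finite form of Gauss's identity
   [psi(q) = \prod_k (1 - q^(2k)) / (1 - q^(2k-1))], cleared of denominators. The
   difference of two consecutive left-hand sides telescopes (see [a] below). *)
Lemma finite_gauss n :
  \sum_(0 <= s < n) evens s n * odds s * q ^+ (s * (2 * n + 1)) =
  odds n * \sum_(0 <= k < 2 * n) q ^+ tri k.
Proof.
elim: n => [|n IHn]; first by rewrite !big_geq // mulr0.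
pose a s := evens s n * odds s * (1 - q ^+ (2 * s)) * q ^+ (s * (2 * n + 1)).
have evensS s : (s <= n)%N -> evens s n.+1 = evens s n * (1 - q ^+ (2 * n + 2)).
  by move=> le_sn; rewrite /evens big_nat_recr.
have oddsS s : odds s.+1 = odds s * (1 - q ^+ (2 * s + 1)).
  by rewrite /odds big_nat_recr.
have step : \sum_(0 <= s < n) evens s n.+1 * odds s * q ^+ (s * (2 * n.+1 + 1)) =
    (1 - q ^+ (2 * n + 1)) *
      \sum_(0 <= s < n) evens s n * odds s * q ^+ (s * (2 * n + 1)) + (a n - a 0%N).
  rewrite -telescope_sumr // big_distrr -big_split /=.
  apply: eq_big_nat => s /andP[_ lt_sn]; rewrite evensS 1?ltnW // /a.
  have -> : evens s n = (1 - q ^+ (2 * s + 2)) * evens s.+1 n.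
    by rewrite /evens big_ltn.
  rewrite oddsS.
  have -> : (2 * s.+1 = 2 * s + 2)%N by lia.
  have -> : (s.+1 * (2 * n + 1) = s * (2 * n + 1) + (2 * n + 1))%N by lia.
  have -> : (s * (2 * n.+1 + 1) = s * (2 * n + 1) + 2 * s)%N by lia.
  rewrite !exprD; ring.
rewrite big_nat_recr //= step IHn.
have -> : (2 * n.+1 = (2 * n).+2)%N by lia.
(* Since [a 0] vanishes, what remains is [a n] plus the new summand s = n. They add up to [odds n]
   times q^(n(2n+1)) (1 - q^(4n+2)), and 1 - q^(4n+2) = (1 - q^(2n+1)) (1 + q^(2n+1)) yields the two
   new triangular exponents. *)
rewrite !big_nat_recr //= oddsS triS tri_double /a evensS //.
have -> : evens n n = 1 by rewrite /evens big_geq.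
rewrite muln0 expr0 subrr mulr0 mul0r subr0.
have -> : (n * ((2 * n).+2 + 1) = n * (2 * n + 1) + 2 * n)%N by lia.
have -> : ((2 * n).+1 = 2 * n + 1)%N by lia.
rewrite !exprD; ring.
Qed.

Lemma odds_evens n :
  odds n * evens 0 n = \prod_(0 <= k < 2 * n) (1 - q ^+ k.+1).
Proof.
elim: n => [|n IHn]; first by rewrite /odds /evens !big_geq // mulr1.
have -> : (2 * n.+1 = (2 * n).+2)%N by lia.
rewrite !big_nat_recr //= -IHn /odds /evens !big_nat_recr //= !addn1 addn2; ring.
Qed.
End FiniteGauss.

(** * Polynomials modulo ['X^N], in place of power series *)

Section CongruenceModXn.
Variables (R : comNzRingType) (N : nat).
Implicit Types p r : {poly R}.

Definition eqmodX p r := forall i, (i < N)%N -> p`_i = r`_i.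

Lemma eqmodX_sym p r : eqmodX p r -> eqmodX r p.
Proof. by move=> h i /h. Qed.

Lemma eqmodX_trans r p s : eqmodX p r -> eqmodX r s -> eqmodX p s.
Proof. by move=> h1 h2 i ltiN; rewrite h1 ?h2. Qed.

Lemma eqmodX_mul p1 r1 p2 r2 :
  eqmodX p1 r1 -> eqmodX p2 r2 -> eqmodX (p1 * p2) (r1 * r2).
Proof.
move=> h1 h2 i ltiN; rewrite !coefM; apply: eq_bigr => j _.
by rewrite h1 ?h2 //; have := ltn_ord j; lia.
Qed.

Lemma eqmodX_mull s p r : eqmodX p r -> eqmodX (s * p) (s * r).
Proof. by move=> h; apply: eqmodX_mul. Qed.

Lemma eqmodX_exp p r k : eqmodX p r -> eqmodX (p ^+ k) (r ^+ k).
Proof. by move=> h; elim: k => // k IHk; rewrite !exprS; apply: eqmodX_mul. Qed.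

Lemma eqmodX_prod1 (I : Type) (s : seq I) (P : pred I) (F : I -> {poly R}) :
  (forall i, P i -> eqmodX (F i) 1) -> eqmodX (\prod_(i <- s | P i) F i) 1.
Proof.
by move=> h; apply: (big_ind (eqmodX^~ 1)) => // p r hp hr; rewrite -[1]mulr1; exact: (eqmodX_mul hp hr).
Qed.

Lemma eqmodX_cancel u v p r :
  eqmodX (u * v) 1 -> eqmodX (u * p) (u * r) -> eqmodX p r.
Proof.
have h s : eqmodX (u * v) 1 -> eqmodX (v * (u * s)) s.
  by move=> h; rewrite -[X in eqmodX _ X]mul1r mulrCA mulrA; apply: eqmodX_mul.
move=> /[dup] /(h p) hp /(h r) hr hur.
by apply: eqmodX_trans (eqmodX_sym hp) (eqmodX_trans (eqmodX_mull v hur) hr).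
Qed.
End CongruenceModXn.

(** * Euler products over ['F_2] and psi as a cube *)

Lemma pchar2 : 2 \in [pchar {poly 'F_2}].
Proof. by rewrite pchar_poly pchar_Fp. Qed.

Lemma opp_F2X (p : {poly 'F_2}) : - p = p.
Proof. exact: (oppr_pchar2 pchar2). Qed.

Lemma exprD_2pow (p r : {poly 'F_2}) k : (p + r) ^+ (2 ^ k) = p ^+ (2 ^ k) + r ^+ (2 ^ k).
Proof.
apply: exprDn_pchar; rewrite pnatX orbC; apply/orP; right.
by rewrite pnatE // pchar2.
Qed.

(** Signs vanish over ['F_2], so this truncates both the product of the 1 + q^(dk) and that of the 1
    - q^(dk), k >= 1. *)
Definition euler d n : {poly 'F_2} := \prod_(0 <= k < n) (1 + 'X^(d * k.+1)).

Lemma euler_frob d n k : euler d n ^+ (2 ^ k) = euler (2 ^ k * d) n.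
Proof.
rewrite /euler -prodrXl; apply: eq_bigr => i _.
by rewrite exprD_2pow expr1n -exprM; congr (1 + 'X^_); lia.
Qed.

Lemma eqmodX_1DXn N d : (N <= d)%N -> eqmodX N (1 + 'X^d : {poly 'F_2}) 1.
Proof. by move=> leNd i ltiN; rewrite coefD coefXn ltn_eqF ?addr0 //; lia. Qed.

(** Each factor beyond the first [m] has exponent at least d(m+1) >= N, hence is 1 modulo ['X^N]. *)
Lemma euler_stable N d m n :
  (N <= d * m.+1)%N -> (m <= n)%N -> eqmodX N (euler d m) (euler d n).
Proof.
move=> leN lemn; rewrite /euler (big_cat_nat _ lemn) //=.
rewrite -[X in eqmodX _ X]mulr1; apply: eqmodX_mull; apply: eqmodX_sym.
rewrite big_nat_cond; apply: eqmodX_prod1 => k /andP[/andP[lemk _] _].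
by apply: eqmodX_1DXn; nia.
Qed.

(* By Frobenius, [F ^ (2 ^ N)] is a series in [X ^ (2 ^ N)], hence 1 modulo [X ^ N]. *)
Lemma euler_unit N n : eqmodX N (euler 1 n * euler 1 n ^+ (2 ^ N).-1) 1.
Proof.
rewrite -exprS prednK ?expn_gt0 // euler_frob.
apply: eqmodX_trans (eqmodX_sym (_ : eqmodX N (euler _ 0) _)) _.
  by apply: euler_stable => //; have := ltn_expl N (isT : 1 < 2)%N; lia.
by rewrite /euler big_geq.
Qed.

Definition psi_trunc K : {poly 'F_2} := \sum_(0 <= k < K) 'X^(tri k).

(** In [finite_gauss] at q = ['X] the summands with s >= 1 are divisible by X^(2N+1), so the left
    side reduces to [evens 'X 0 N]. Multiplying by [evens 'X 0 N] turns the identity into F psi =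
    F(q^2)^2 = F^4, and the unit F cancels. *)
Lemma psi_cube N : eqmodX N (psi_trunc (2 * N)) (euler 1 (2 * N) ^+ 3).
Proof.
apply: eqmodX_cancel (@euler_unit N (2 * N)) _.
have -> : euler 1 (2 * N) = odds 'X N * evens 'X 0 N.
  by rewrite odds_evens; apply: eq_bigr => k _; rewrite opp_F2X mul1n.
rewrite -exprS mulrAC -finite_gauss odds_evens.
have hE : evens ('X : {poly 'F_2}) 0 N = euler 2 N.
  by apply: eq_bigr => k _; rewrite opp_F2X; congr (1 + 'X^_); lia.
have -> : \prod_(0 <= k < 2 * N) (1 - 'X ^+ k.+1) = euler 1 (2 * N).
  by apply: eq_bigr => k _; rewrite opp_F2X mul1n.
rewrite -[4%N]/(2 ^ 2)%N euler_frob.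
have h2 : eqmodX N (evens 'X 0 N * evens 'X 0 N) (euler (2 ^ 2 * 1) (2 * N)).
  rewrite hE -expr2 -[X in _ ^+ X]/(2 ^ 1)%N euler_frob.
  by apply: euler_stable; lia.
apply: eqmodX_trans h2; rewrite mulrC; apply: eqmodX_mull.
move=> i ltiN; rewrite coef_sum; case: N ltiN {hE} => // N ltiN.
have odds0 : odds ('X : {poly 'F_2}) 0 = 1 by rewrite /odds big_geq.
rewrite big_ltn // mul0n expr0 odds0 !mulr1.
rewrite big_nat_cond big1 ?addr0 // => s /andP[/andP[lts _] _].
by rewrite coefMXn; case: ifP => //; nia.
Qed.

(** * Generating function of regular partitions modulo 2 *)

Lemma Fp_natr_eq p m n : prime p -> (m%:R == n%:R :> 'F_p) = (m == n %[mod p]).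
Proof. by move=> pp; rewrite -(inj_eq val_inj) /= !val_Fp_nat. Qed.

(** [b l n] is the diagonal case m = n; a separate bound [m] on the parts allows induction on it. *)
Definition regular_count l m n :=
  count (all (fun x => ~~ (l %| x)%N)) (parts_le m n).

Lemma regular_countS l m n : regular_count l m.+1 n =
  (\sum_(0 <= k < (n %/ m.+1).+1)
     ((k == 0) || ~~ (l %| m.+1)) * regular_count l m (n - k * m.+1))%N.
Proof.
rewrite {1}/regular_count {1}/parts_le -/parts_le count_flatten -map_comp sumnE big_map /index_iota subn0.
apply: eq_bigr => k _ /=; rewrite count_map.
rewrite (eq_count (a2 := fun s => ((k == 0%N) || ~~ (l %| m.+1)%N)
                              && all (fun x => ~~ (l %| x)%N) s)); last first.
  by move=> s; elim: k => //= k ->; case: (l %| m.+1)%N; rewrite /= ?orbT.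
by case: (_ || _); [exact: (esym (mul1n _)) | exact: count_pred0].
Qed.

Lemma regular_count_dvd l m n :
  (l %| m.+1)%N -> regular_count l m.+1 n = regular_count l m n.
Proof.
move=> dvd; rewrite regular_countS big_ltn // mul0n subn0 mul1n.
by rewrite big_nat_cond big1 ?addn0 // => k; rewrite dvd orbF andbT; case: k.
Qed.

(** The term k = 0 counts the partitions without the part m+1; the terms k >= 1 count the others
    after removal of one copy. *)
Lemma regular_count_ndvd l m n : ~~ (l %| m.+1)%N ->
  regular_count l m.+1 n = (regular_count l m n +
    if m.+1 <= n then regular_count l m.+1 (n - m.+1) else 0)%N.
Proof.
move=> ndvd; rewrite !regular_countS big_ltn // mul0n subn0 mul1n; congr (_ + _)%N.
case: leqP => [le_nm|le_mn]; first by rewrite divn_small // big_geq.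
rewrite -{1}(subnK le_mn) divnDr // divnn addn1 big_add1 /=.
by apply: eq_bigr => k _; rewrite ndvd orbT mulSn subnDA.
Qed.

Definition regular_gf l N m : {poly 'F_2} :=
  \poly_(i < N) (regular_count l m i)%:R.

(** By the recurrences, an allowed part m+1 contributes a factor 1 / (1 - X^(m+1)), and over ['F_2]
    the denominator is 1 + X^(m+1). *)
Lemma regular_gf_prod l N m : eqmodX N
  (regular_gf l N m * \prod_(0 <= k < m | ~~ (l %| k.+1)%N) (1 + 'X^(k.+1))) 1.
Proof.
elim: m => [|m IHm].
  rewrite big_geq // mulr1 => i ltiN; rewrite coef_poly ltiN coef1.
  by case: i ltiN.
rewrite big_mkcond big_nat_recr //= -big_mkcond /=; case: ifPn => [ndvd|]; last first.
  rewrite negbK => dvd; rewrite mulr1; suff -> : regular_gf l N m.+1 = regular_gf l N m by [].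
  by apply/polyP => j; rewrite !coef_poly regular_count_dvd.
apply: eqmodX_trans IHm; rewrite mulrCA mulrC; apply: eqmodX_mul => // i ltiN.
rewrite mulrDr mulr1 coefD coefMXn !coef_poly ltiN (leq_ltn_trans (leq_subr _ _) ltiN).
rewrite regular_count_ndvd // natrD ltnS; case: leqP => _; first by rewrite !addr0.
by rewrite -addrA (addrr_pchar2 (pchar_Fp (isT : prime 2))) addr0.
Qed.

Lemma prod_dvd_euler l m : (0 < l)%N ->
  \prod_(0 <= k < m | (l %| k.+1)%N) (1 + 'X^(k.+1)) = euler l (m %/ l).
Proof.
move=> l_gt0; elim: m => [|m IHm]; first by rewrite div0n /euler !big_geq.
rewrite big_mkcond big_nat_recr //= -big_mkcond /= IHm divnS //; case: ifP => [dvd|]; last by rewrite mulr1.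
rewrite add1n /euler [in RHS]big_nat_recr //=; congr (_ * (1 + 'X^_)).
by have := divnK dvd; rewrite divnS // dvd add1n mulnC.
Qed.

(** Multiply by F: its factors with exponent prime to divisibility by 16 cancel the generating
    function, and the others form [euler 16], which is F^16 by Frobenius. Then cancel F. *)
Lemma b16_gf n : eqmodX n.+1 (regular_gf 16 n.+1 n) (euler 1 n ^+ 15).
Proof.
apply: eqmodX_cancel (@euler_unit n.+1 n) _; rewrite -exprS -[16%N]/(2 ^ 4)%N euler_frob.
have {1}-> : euler 1 n = \prod_(0 <= k < n | ~~ (16 %| k.+1)%N) (1 + 'X^(k.+1))
                     * euler 16 (n %/ 16).
  rewrite -prod_dvd_euler // mulrC /euler (bigID (fun k => 16 %| k.+1)%N) /=.
  by congr (_ * _); apply: eq_bigr => k _; rewrite mul1n.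
apply: eqmodX_trans (_ : eqmodX _ (euler 16 (n %/ 16)) _); last first.
  by apply: euler_stable; lia.
rewrite mulrC mulrA -[X in eqmodX _ _ X]mul1r.
by apply: eqmodX_mul => //; apply: regular_gf_prod.
Qed.

(** * Parity of [b 16] as a double sum over triangular numbers *)

Lemma psi_trunc_frob K :
  psi_trunc K ^+ 4 = \sum_(0 <= k < K) 'X^(4 * tri k).
Proof.
rewrite /psi_trunc -[X in _ ^+ X]/(2 ^ 2)%N.
elim: K => [|K IHK]; first by rewrite !big_geq // expr0n.
by rewrite !big_nat_recr //= exprD_2pow IHK -exprM mulnC.
Qed.

Lemma b16_parity n :
  b 16 n = \sum_(0 <= i < 2 * n.+1) \sum_(0 <= j < 2 * n.+1)
             (tri i + 4 * tri j == n) %[mod 2].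
Proof.
apply/eqP; rewrite -Fp_natr_eq //; apply/eqP.
have -> : (b 16 n)%:R = (regular_gf 16 n.+1 n)`_n by rewrite coef_poly ltnSn.
(* The length [2 * n.+1] is the one at which [psi_cube] is valid modulo X^(n+1). *)
rewrite (b16_gf (ltnSn n)).
have hF : eqmodX n.+1 (euler 1 n) (euler 1 (2 * n.+1)) by apply: euler_stable; lia.
have hpsi : eqmodX n.+1 (euler 1 n ^+ 15) (psi_trunc (2 * n.+1) ^+ 5).
  apply: eqmodX_trans (eqmodX_exp 15 hF) _; rewrite -[15%N]/(3 * 5)%N exprM.
  by apply: eqmodX_exp; apply: eqmodX_sym; apply: psi_cube.
rewrite (hpsi _ (ltnSn n)) exprS psi_trunc_frob /psi_trunc big_distrl coef_sum.
rewrite natr_sum; apply: eq_bigr => i _.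
rewrite big_distrr coef_sum natr_sum; apply: eq_bigr => j _.
by rewrite /= -exprD coefXn eq_sym.
Qed.

(* Coefficients of psi(q) psi(q^4) as representation counts *)
Close Scope ring_scope.

Lemma psiE K n : n < K -> psi n = \sum_(0 <= i < K) (tri i == n).
Proof.
move=> lt_nK; rewrite /psi [RHS](big_cat_nat _ (n := n.+1)) //=.
rewrite [X in _ + X]big_nat_cond [X in _ + X]big1 ?addn0 // => i /andP[/andP[lt_ni _] _].
by apply/eqP; rewrite eqb0; have := leq_tri i; lia.
Qed.

Lemma subst_psiE K n : n < K ->
  series_subst 4 psi n = \sum_(0 <= j < K) (4 * tri j == n).
Proof.
move=> lt_nK; rewrite /series_subst; case: ifPn => [dvd|ndvd].
  rewrite (@psiE K) ?(leq_ltn_trans (leq_div _ _)) //.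
  by apply: eq_bigr => j _; congr (nat_of_bool _); lia.
by rewrite big1 // => j _; apply/eqP; rewrite eqb0; lia.
Qed.

Lemma psi_mul_subst n K : n < K ->
  series_mul psi (series_subst 4 psi) n =
  \sum_(0 <= i < K) \sum_(0 <= j < K) (tri i + 4 * tri j == n).
Proof.
move=> lt_nK; rewrite /series_mul.
under eq_big_nat => k /andP[_ lt_kn].
  rewrite (@psiE K) ?(@subst_psiE K); [|lia|lia].
  rewrite big_distrl /=; under eq_bigr => i _ do rewrite big_distrr /=.
  over.
rewrite exchange_big; apply: eq_bigr => i _ /=.
rewrite exchange_big; apply: eq_bigr => j _ /=.
(* For fixed i and j only k = [tri i] can contribute to the Cauchy product. *)
move: (tri i) (tri j) => a c; case: eqP => [<-|ne].
  rewrite (big_cat_nat _ (n := a)) //=; last by lia.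
  rewrite [X in _ + X]big_ltn; last by lia.
  rewrite big_nat_cond big1; last first.
    by move=> k /andP[/andP[_ lt] _]; rewrite gtn_eqF.
  rewrite big_nat_cond big1; last first.
    by move=> k /andP[/andP[lt _] _]; rewrite ltn_eqF.
  by rewrite eqxx addKn eqxx.
rewrite big_nat_cond big1 // => k /andP[/andP[_ lt] _].
by apply/eqP; rewrite muln_eq0 !eqb0; lia.
Qed.

(** The search box loses nothing, as x <= x^2 and y <= 4y^2. *)
Definition odd_reps M : seq (nat * nat) :=
  [seq xy <- allpairs pair (iota 0 M.+1) (iota 0 M.+1) |
    [&& odd xy.1, odd xy.2 & xy.1 ^ 2 + 4 * xy.2 ^ 2 == M]].

Lemma odd_reps_uniq (M : nat) : uniq (odd_reps M).
Proof.
apply: filter_uniq; apply: allpairs_uniq; rewrite ?iota_uniq //.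
by move=> [? ?] [? ?] _ _ [-> ->].
Qed.

Lemma mem_odd_reps (M x y : nat) :
  ((x, y) \in odd_reps M) = [&& odd x, odd y & x ^ 2 + 4 * y ^ 2 == M].
Proof.
rewrite mem_filter; case: and3P => // -[_ _ /eqP eqM].
apply/andP; split=> //; apply/allpairsP; exists (x, y); rewrite !mem_iota; split=> //=;
  by rewrite /= in eqM; nia.
Qed.

(** The bijection (i, j) -> (2i+1, 2j+1) rests on (2i+1)^2 + 4(2j+1)^2 = 8 (tri i + 4 tri j) + 5. *)
Lemma psi_mul_odd_reps n :
  series_mul psi (series_subst 4 psi) n = size (odd_reps (8 * n + 5)).
Proof.
rewrite (psi_mul_subst (ltnSn n)).
pose s := [seq ij <- allpairs pair (iota 0 n.+1) (iota 0 n.+1) |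
            tri ij.1 + 4 * tri ij.2 == n].
have -> : \sum_(0 <= i < n.+1) \sum_(0 <= j < n.+1) (tri i + 4 * tri j == n) = size s.
  rewrite size_filter -sum1_count [RHS]big_mkcond [RHS]big_allpairs /index_iota subn0.
  by apply: eq_bigr => i _; apply: eq_bigr => j _ /=; case: (_ == _).
pose f (ij : nat * nat) := (2 * ij.1 + 1, 2 * ij.2 + 1).
have f_inj : injective f by move=> [i j] [i' j'] [] *; congr pair; lia.
rewrite -(size_map f); apply: perm_size; apply: uniq_perm.
- rewrite map_inj_uniq // filter_uniq //; apply: allpairs_uniq; rewrite ?iota_uniq //.
  by move=> [? ?] [? ?] _ _ [-> ->].
- exact: odd_reps_uniq.
move=> [x y]; rewrite mem_odd_reps; apply/mapP/and3P.
  move=> [[i j]]; rewrite mem_filter /= => /andP[/eqP eqn _] [-> ->].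
  split; [by lia | by lia | apply/eqP].
  by have := mul2_tri i; have := mul2_tri j; nia.
move=> [odd_x odd_y /eqP eqM].
have [i def_x] : exists i, x = 2 * i + 1 by exists x./2; lia.
have [j def_y] : exists j, y = 2 * j + 1 by exists y./2; lia.
exists (i, j); last by rewrite def_x def_y.
have := mul2_tri i; have := mul2_tri j => hj hi.
have eqn : tri i + 4 * tri j = n by subst; nia.
rewrite mem_filter; apply/andP; split; [exact/eqP | apply/allpairsP]; exists (i, j).
have := leq_tri i; have := leq_tri j => leqj leqi.
by split=> //; rewrite mem_iota /=; lia.
Qed.

(** * Descent at primes congruent to 3 modulo 4 *)

Lemma dvdn_add_sqr p u v : prime p -> p %% 4 = 3 ->
  p %| u ^ 2 + v ^ 2 -> p %| u.
Proof.
move=> pp hp; rewrite !(dvdn_pcharf (pchar_Fp pp)) natrD !natrX addr_eq0.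
have fermat a : (a%:R ^+ p.+1 = a%:R ^+ 2 :> 'F_p)%R.
  rewrite exprSr -natrX expr2; congr (_ * _)%R; apply/eqP.
  by rewrite Fp_natr_eq // fermat_little.
(* The exponent (p+1)/2 is even, so raising u^2 = -v^2 to it loses the sign; with [fermat] this
   gives u^2 = v^2, hence 2u^2 = 0. *)
have def_p : p.+1 = 2 * (2 * (p %/ 4).+1) by lia.
move=> /eqP hu; have : (u%:R ^+ 2 = v%:R ^+ 2 :> 'F_p)%R.
  by rewrite -!fermat def_p exprM hu exprM sqrrN -exprM -exprM; congr (_ ^+ _)%R; lia.
move=> huv; have : (2%:R * u%:R ^+ 2 == 0 :> 'F_p)%R.
  by rewrite mulr_natl mulr2n addr_eq0 {2}huv; apply/eqP.
rewrite -natrX -natrM -!(dvdn_pcharf (pchar_Fp pp)) Euclid_dvdM // Euclid_dvdX //.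
case/orP=> [/(dvdn_leq _) h|/andP[]//].
by have := h isT; have := prime_gt1 pp; case: (p =P 2) hp => [->|] //; lia.
Qed.

Lemma modn8_exp_even p alpha : odd p -> p ^ (2 * alpha) %% 8 = 1.
Proof.
move=> odd_p; have sqr1 : p ^ 2 %% 8 = 1.
  (* With p = 2k+1, p^2 = 8 tri k + 1. *)
  by have := mul2_tri p./2; nia.
by rewrite expnM -modnXm sqr1 exp1n.
Qed.

Section Descent.
Variables (p : nat) (pp : prime p) (hp : p %% 4 = 3).

Lemma odd_reps_dvdn M x y :
  p %| M -> (x, y) \in odd_reps M -> (p %| x) && (p %| y).
Proof.
have p_gt2 : 2 < p by move: (prime_gt1 pp) hp; lia.
move=> dvdM; rewrite mem_odd_reps => /and3P[_ _ /eqP defM].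
have hM : p %| x ^ 2 + (2 * y) ^ 2 by rewrite expnMn defM.
rewrite (dvdn_add_sqr pp hp hM) /=; rewrite addnC in hM.
have := dvdn_add_sqr pp hp hM.
by rewrite Euclid_dvdM // gtnNdvd.
Qed.

Lemma odd_reps_eq0 M : p %| M -> ~~ (p ^ 2 %| M) -> odd_reps M = [::].
Proof.
move=> dvdM ndvdM; case def_s: (odd_reps M) => [//|[x y] s].
have in_xy : (x, y) \in odd_reps M by rewrite def_s mem_head.
have /andP[dvdx dvdy] := odd_reps_dvdn dvdM in_xy.
move: in_xy; rewrite mem_odd_reps => /and3P[_ _ /eqP defM].
case/negP: ndvdM; rewrite -defM.
by apply: dvdn_add; [|apply: dvdn_mull]; apply: dvdn_exp2r.
Qed.

(** Scaling by the odd [p] preserves parity, and [odd_reps_dvdn] makes it surjective. *)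
Lemma size_odd_reps_sqr M : size (odd_reps (p ^ 2 * M)) = size (odd_reps M).
Proof.
have p_gt0 := prime_gt0 pp; have odd_p : odd p by move: hp; lia.
pose f (xy : nat * nat) := (p * xy.1, p * xy.2).
have f_inj : injective f.
  move=> [x y] [x' y'] [] /eqP + /eqP.
  by rewrite !eqn_pmul2l // => /eqP-> /eqP->.
have eqM x y : (((p * x) ^ 2 + 4 * (p * y) ^ 2 == p ^ 2 * M)
                = (x ^ 2 + 4 * y ^ 2 == M))%N.
  by rewrite !expnMn mulnCA -mulnDr eqn_pmul2l // expn_gt0 p_gt0.
rewrite -(size_map f (odd_reps M)); apply: perm_size; apply: uniq_perm.
- exact: odd_reps_uniq.
- by rewrite map_inj_uniq // odd_reps_uniq.
move=> [x y]; apply/idP/mapP => [in_xy|[[x' y']]].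
  have /andP[/dvdnP[x' def_x] /dvdnP[y' def_y]] :=
    odd_reps_dvdn (dvdn_mulr M (dvdn_mulr p (dvdnn p))) in_xy.
  exists (x', y'); last by rewrite /f def_x def_y ![_ * p]mulnC.
  move: in_xy; rewrite !mem_odd_reps def_x def_y ![_ * p]mulnC !oddM odd_p /=.
  by rewrite eqM.
by rewrite mem_odd_reps => /and3P[ox oy eqxy] [-> ->]; rewrite mem_odd_reps !oddM
  odd_p ox oy eqM.
Qed.

Lemma size_odd_reps_exp alpha M :
  size (odd_reps (p ^ (2 * alpha) * M)) = size (odd_reps M).
Proof.
elim: alpha => [|a IHa]; first by rewrite muln0 mul1n.
by rewrite mulnS expnD -mulnA size_odd_reps_sqr.
Qed.
End Descent.

(** * Both congruences from representation counts *)

Lemma b16_odd_reps n : b 16 n = size (odd_reps (8 * n + 5)) %[mod 2].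
Proof. by rewrite b16_parity -psi_mul_subst ?psi_mul_odd_reps //; lia. Qed.

Theorem theorem3p24 (p : nat) (pp : prime p) (hp : p %% 4 = 3) (alpha : nat) :
  cong2 (fun n => b 16 (p ^ (2 * alpha) * n + (5 * p ^ (2 * alpha) - 5) %/ 8))
        (series_mul psi (series_subst 4 psi))
  /\ (forall n i, 1 <= i <= p - 1 ->
        b 16 (p ^ (2 * alpha + 2) * n + ((8 * i + 5 * p) * p ^ (2 * alpha + 1) - 5) %/ 8)
          = 0 %[mod 2]).
Proof.
have odd_p : odd p by lia.
split=> [n|n i /andP[i_gt0 lt_ip]]; rewrite b16_odd_reps.
  rewrite psi_mul_odd_reps -[in RHS](size_odd_reps_exp pp hp alpha).
  congr (size (odd_reps _) %% 2).
  (* As p^(2 alpha) = 8t + 1, the division by 8 is exact and the index n goes to p^(2 alpha) (8n +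
     5). *)
  have := modn8_exp_even alpha odd_p; move: (p ^ _) => P P_mod.
  have [t ->] : exists t, P = 8 * t + 1 by exists (P %/ 8); lia.
  by have -> : (5 * (8 * t + 1) - 5) %/ 8 = 5 * t; lia.
have -> : 8 * (p ^ (2 * alpha + 2) * n
             + ((8 * i + 5 * p) * p ^ (2 * alpha + 1) - 5) %/ 8) + 5
        = p ^ (2 * alpha) * (p * (8 * (p * n + i) + 5 * p)).
  have := modn8_exp_even alpha.+1 odd_p.
  have -> : 2 * alpha.+1 = 2 * alpha + 2 by lia.
  rewrite (expnD p _ 2) (expnD p _ 1) expn1 -mulnn; move: (p ^ (2 * alpha)) => P Q_mod.
  have -> : (8 * i + 5 * p) * (P * p) = 8 * (i * (P * p)) + 5 * (P * (p * p)) by lia.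
  have -> : (8 * (i * (P * p)) + 5 * (P * (p * p)) - 5) %/ 8
    = i * (P * p) + 5 * (P * (p * p) %/ 8).
    by move: (i * (P * p)) (P * (p * p)) Q_mod => A Q; lia.
  have := divn_eq (P * (p * p)) 8; rewrite Q_mod => defQ.
  have -> : P * (p * (8 * (p * n + i) + 5 * p))
    = 8 * (P * (p * p) * n + i * (P * p)) + 5 * (P * (p * p)) by lia.
  by move: (P * (p * p) * n) (i * (P * p)) => B A; lia.
(* After p^(2 alpha) is stripped, [p] divides the rest exactly once: the cofactor is 8i modulo [p],
   with 0 < i < p and [p] odd. *)
rewrite size_odd_reps_exp // (odd_reps_eq0 pp hp (dvdn_mulr _ (dvdnn p))) //.
rewrite -mulnn dvdn_pmul2l ?prime_gt0 // (dvdn_addl _ (dvdn_mull 5 (dvdnn p))).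
rewrite Euclid_dvdM // (dvdn_addr _ (dvdn_mulr n (dvdnn p))).
rewrite (gtnNdvd i_gt0) ?orbF; last by lia.
rewrite -[8]/(2 ^ 3) Euclid_dvdX // andbT dvdn_prime2 //.
by apply/eqP => p2; rewrite p2 in odd_p.
Qed.
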